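(* Let $f_!\dashv f^*$ be an adjunction with Nakayama functor $\nu$ (between abelian categories $\mathcal A$ and $\mathcal C$, $f^*:\mathcal A\to\mathcal C$). Assume that $f_!\dashv f^*$ is Iwanaga–Gorenstein of dimension $n\le1$. Let $g$ be a morphism in $\mathcal A$. (i) If $g$ is right almost split in $\mathcal A$, then $\nu^-(g)$ is either a split epimorphism or right almost split in $\mathcal G_{f_!}\mathrm{proj}$. (ii) If $g$ is left almost split in $\mathcal A$, then $\nu(g)$ is either a split monomorphism or left almost split in $\mathcal G_{f_*}\mathrm{inj}$.
   Context: All functors are additive. Let $\mathcal A,\mathcal C$ be abelian categories and $f^*:\mathcal A\to\mathcal C$ a faithful functor with left adjoint $f_!:\mathcal C\to\mathcal A$. A Nakayama functor with respect to $f_!\dashv f^*$ is a functor $\nu:\mathcal A\to\mathcal A$ with a right adjoint $\nu^-:\mathcal A\to\mathcal A$ such that (a) $\nu\circ f_!$ is right adjoint to $f^*$, and (b) the unit of $\nu\dashv\nu^-$ induces a natural isomorphism $f_!\to\nu^-\circ\nu\circ f_!$. Put $f_*:=\nu\circ f_!$. Relative projective (resp. relative injective) objects of $\mathcal A$ are direct summands of objects in the essential image of $f_!$ (resp. $f_*$). $\mathcal G_{f_!}\mathrm{proj}$ (relative Gorenstein projectives) is the full subcategory of $\mathcal A$ of objects $\operatorname{Ker}(Q_0\to Q_{-1})$ for exact complexes $Q_\bullet=\cdots\to Q_1\to Q_0\to Q_{-1}\to\cdots$ of relative projectives with $\nu(Q_\bullet)$ exact. $\mathcal G_{f_*}\mathrm{inj}$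 (relative Gorenstein injectives) is the full subcategory of objects $\operatorname{Ker}(J_0\to J_{-1})$ for exact complexes $J_\bullet$ of relative injectives with $\nu^-(J_\bullet)$ exact. The derived functors $L_j\nu$ and $R^j\nu^-$ exist and are computed by resolutions by relative projectives, resp. coresolutions by relative injectives. The adjunction is Iwanaga–Gorenstein if there is an integer $n$ with $L_j\nu=0$ and $R^j\nu^-=0$ for all $j>n$; its dimension is the smallest such $n$. A morphism $g:A\to A'$ in a category is right almost split if it is not a split epimorphism and every morphism $B\to A'$ which is not a split epimorphism factors through $g$; left almost split is dual. *)

(* Defs.v *)
From HB Require Import structures.
From mathcomp Require Import all_boot all_order all_algebra.
Set Implicit Arguments.
Unset Strict Implicit.
Unset Printing Implicit Defensive.
Import GRing.Theory.
Local Open Scope ring_scope.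

Declare Scope cat_scope.
Delimit Scope cat_scope with cat.
Reserved Notation "g ∘ f" (at level 40, left associativity).

Record preaddCat := PreaddCat {
  Obj :> Type;
  hom : Obj -> Obj -> zmodType;
  idm : forall A, hom A A;
  compm : forall A B C, hom B C -> hom A B -> hom A C;
  compA : forall A B C D (h : hom C D) (g : hom B C) (f : hom A B),
    compm h (compm g f) = compm (compm h g) f;
  comp1m : forall A B (f : hom A B), compm (idm B) f = f;
  compm1 : forall A B (f : hom A B), compm f (idm A) = f;
  compDl : forall A B C (g g' : hom B C) (f : hom A B),
    compm (g + g') f = compm g f + compm g' f;
  compDr : forall A B C (g : hom B C) (f f' : hom A B),
    compm g (f + f') = compm g f + compm g f'
}.

Arguments hom {p} _ _.
Arguments idm {p} A.
Arguments compm {p A B C} g f.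

Notation "g ∘ f" := (compm g f) : cat_scope.
Local Open Scope cat_scope.

Section Morphisms.
Variable K : preaddCat.
Implicit Types A B C : K.

Definition mono A B (f : hom A B) :=
  forall X (u v : hom X A), f ∘ u = f ∘ v -> u = v.

Definition epi A B (f : hom A B) :=
  forall X (u v : hom B X), u ∘ f = v ∘ f -> u = v.

Definition split_mono A B (f : hom A B) := exists r : hom B A, r ∘ f = idm A.

Definition split_epi A B (f : hom A B) := exists s : hom B A, f ∘ s = idm B.

Definition is_iso A B (f : hom A B) :=
  exists g : hom B A, g ∘ f = idm A /\ f ∘ g = idm B.

Definition isomorphic A B := exists f : hom A B, is_iso f.

Definition is_zero A :=
  (forall X (f : hom A X), f = 0) /\ (forall X (f : hom X A), f = 0).

Definition is_biproduct A1 A2 B :=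
  exists (i1 : hom A1 B) (i2 : hom A2 B) (p1 : hom B A1) (p2 : hom B A2),
    [/\ p1 ∘ i1 = idm A1, p2 ∘ i2 = idm A2, p1 ∘ i2 = 0, p2 ∘ i1 = 0
      & i1 ∘ p1 + i2 ∘ p2 = idm B].

Definition direct_summand A B := exists A', is_biproduct A A' B.

Definition is_kernel A B (f : hom A B) X (k : hom X A) :=
  f ∘ k = 0 /\
  forall Y (h : hom Y A), f ∘ h = 0 -> exists! u : hom Y X, k ∘ u = h.

Definition is_cokernel A B (f : hom A B) X (c : hom B X) :=
  c ∘ f = 0 /\
  forall Y (h : hom B Y), h ∘ f = 0 -> exists! u : hom X Y, u ∘ c = h.

Definition is_image A B (f : hom A B) X (m : hom X B) :=
  exists Y (c : hom B Y), is_cokernel f c /\ is_kernel c m.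

Definition exact A B C (f : hom A B) (g : hom B C) :=
  exists X (m : hom X B), is_image f m /\ is_kernel g m.

(** [H] is (a representative of) the homology at [B]: the cokernel of the map
    from [A] to the kernel of [g] induced by [f]. *)
Definition is_homology A B C (f : hom A B) (g : hom B C) H :=
  exists X (k : hom X B) (u : hom A X) (c : hom X H),
    [/\ is_kernel g k, k ∘ u = f & is_cokernel u c].

Definition is_abelian :=
  [/\ exists Z : K, is_zero Z,
      forall A1 A2 : K, exists B, is_biproduct A1 A2 B,
      forall (A B : K) (f : hom A B),
        (exists X (k : hom X A), is_kernel f k) /\
        (exists X (c : hom B X), is_cokernel f c),
      forall (A B : K) (f : hom A B), mono f ->
        exists X (g : hom B X), is_kernel g f
    & forall (A B : K) (f : hom A B), epi f ->
        exists X (g : hom X A), is_cokernel g f].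

Definition right_almost_split A A' (g : hom A A') :=
  ~ split_epi g /\
  forall B (h : hom B A'), ~ split_epi h -> exists k : hom B A, g ∘ k = h.

Definition left_almost_split A A' (g : hom A A') :=
  ~ split_mono g /\
  forall B (h : hom A B), ~ split_mono h -> exists k : hom A' B, k ∘ g = h.

End Morphisms.

Section FullSubcategory.
Variable K : preaddCat.

Definition full_sub (P : K -> Prop) : preaddCat :=
  @PreaddCat {A : K | P A} (fun S T => hom (sval S) (sval T))
    (fun S => idm (sval S)) (fun _ _ _ g f => g ∘ f)
    (fun _ _ _ _ => @compA K _ _ _ _) (fun _ _ => @comp1m K _ _)
    (fun _ _ => @compm1 K _ _) (fun _ _ _ => @compDl K _ _ _)
    (fun _ _ _ => @compDr K _ _ _).

(** These include that the source and target of [g] satisfy [P]. *)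
Definition right_almost_split_in (P : K -> Prop) (A A' : K) (g : hom A A') :=
  exists (PA : P A) (PA' : P A'),
    @right_almost_split (full_sub P) (exist P A PA) (exist P A' PA') g.

Definition left_almost_split_in (P : K -> Prop) (A A' : K) (g : hom A A') :=
  exists (PA : P A) (PA' : P A'),
    @left_almost_split (full_sub P) (exist P A PA) (exist P A' PA') g.

End FullSubcategory.

Record abelianCat := AbelianCat {
  abcat :> preaddCat;
  abcatP : is_abelian abcat
}.

Record functor (K L : preaddCat) := Functor {
  fobj :> K -> L;
  fmap : forall A B, hom A B -> hom (fobj A) (fobj B);
  fmap1 : forall A, fmap (idm A) = idm (fobj A);
  fmap_comp : forall A B C (g : hom B C) (f : hom A B),
    fmap (g ∘ f) = fmap g ∘ fmap f;
  fmapD : forall A B (f g : hom A B), fmap (f + g) = fmap f + fmap g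
}.

Arguments fmap {K L} _ {A B} _.

Definition faithful (K L : preaddCat) (F : functor K L) :=
  forall A B (f g : hom A B), fmap F f = fmap F g -> f = g.

Lemma fcomp1 (K L M : preaddCat) (G : functor L M) (F : functor K L) (A : K) :
  fmap G (fmap F (idm A)) = idm (G (F A)).
Proof. by rewrite !fmap1. Qed.

Lemma fcomp_comp (K L M : preaddCat) (G : functor L M) (F : functor K L)
  (A B C : K) (g : hom B C) (f : hom A B) :
  fmap G (fmap F (g ∘ f)) = fmap G (fmap F g) ∘ fmap G (fmap F f).
Proof. by rewrite !fmap_comp. Qed.

Lemma fcompD (K L M : preaddCat) (G : functor L M) (F : functor K L)
  (A B : K) (f g : hom A B) :
  fmap G (fmap F (f + g)) = fmap G (fmap F f) + fmap G (fmap F g).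
Proof. by rewrite !fmapD. Qed.

Definition fcomp (K L M : preaddCat) (G : functor L M) (F : functor K L) :
    functor K M :=
  @Functor K M (fun A => G (F A)) (fun _ _ f => fmap G (fmap F f))
    (fcomp1 G F) (@fcomp_comp K L M G F) (@fcompD K L M G F).

(** [adjunction F G] : [F] is left adjoint to [G]. *)
Record adjunction (K L : preaddCat) (F : functor K L) (G : functor L K) :=
  Adjunction {
  unit_ : forall A : K, hom A (G (F A));
  counit : forall B : L, hom (F (G B)) B;
  unit_nat : forall (A A' : K) (f : hom A A'),
    unit_ A' ∘ f = fmap G (fmap F f) ∘ unit_ A;
  counit_nat : forall (B B' : L) (g : hom B B'),
    counit B' ∘ fmap F (fmap G g) = g ∘ counit B;
  triangle_l : forall A : K, counit (F A) ∘ fmap F (unit_ A) = idm (F A);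
  triangle_r : forall B : L, fmap G (counit B) ∘ unit_ (G B) = idm (G B)
}.

(** Here and below, [fl] stands for f_! and [fs] for f^*. *)
Record nakayama (A C : abelianCat) (fs : functor A C) (fl : functor C A)
    (adj : adjunction fl fs) := Nakayama {
  nu : functor A A;
  nu_minus : functor A A;
  nu_adj : adjunction nu nu_minus;
  nu_right_adj : inhabited (adjunction fs (fcomp nu fl));
  nu_unit_iso : forall X : C, is_iso (unit_ nu_adj (fl X))
}.

(** The degree [predz i] is [i - 1], by cases so that it reduces on
    constructors (and in particular [predz 0] is [-1]). *)
Definition predz (i : int) : int :=
  match i with
  | Posz 0 => Negz 0
  | Posz n.+1 => Posz n
  | Negz n => Negz n.+1
  end.

Lemma predzE i : predz i = i - 1.
Proof.
case: i => [[|n]|n] //=; first by rewrite intS addrC addKr.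
by rewrite !NegzE [n.+2%:Z]intS opprD addrC.
Qed.

Definition exact_complex (K : preaddCat) (X : int -> K)
    (d : forall i, hom (X i) (X (predz i))) :=
  forall i, exact (d i) (d (predz i)).

Section Relative.
Variable K : preaddCat.

Definition essential_image (L : preaddCat) (F : functor L K) (B : K) :=
  exists X : L, isomorphic (F X) B.

(** Summands of objects in the essential image of [F]: the relative
    projectives for [F = f_!] and the relative injectives for [F = f_*]. *)
Definition relative_obj (L : preaddCat) (F : functor L K) (A : K) :=
  exists B : K, essential_image F B /\ direct_summand A B.

(** Kernels of the degree 0 differential of the exact complexes of objects in
    [P] that [F] sends to exact complexes. *)
Definition gorenstein (P : K -> Prop) (F : functor K K) (A : K) :=
  exists (X : int -> K) (d : forall i, hom (X i) (X (predz i))),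
    [/\ forall i, P (X i),
        exact_complex d,
        exact_complex (fun i => fmap F (d i))
      & exists k : hom A (X 0), is_kernel (d 0) k].

Definition resolution (P : K -> Prop) (A : K) (X : nat -> K)
    (d : forall j, hom (X j.+1) (X j)) (e : hom (X 0%N) A) :=
  [/\ forall j, P (X j), epi e, exact (d 0%N) e
    & forall j, exact (d j.+1) (d j)].

Definition coresolution (P : K -> Prop) (A : K) (X : nat -> K)
    (d : forall j, hom (X j) (X j.+1)) (e : hom A (X 0%N)) :=
  [/\ forall j, P (X j), mono e, exact e (d 0%N)
    & forall j, exact (d j) (d j.+1)].

(** [left_derived P F j A L]: [L] represents [L_j F (A)], computed as the
    homology in degree [j] of [F] applied to a resolution of [A] by objects in
    [P]. Different resolutions may produce different (isomorphic)
    representatives. *)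
Definition left_derived (P : K -> Prop) (F : functor K K) (j : nat) (A L : K) :=
  exists (X : nat -> K) (d : forall j, hom (X j.+1) (X j)) (e : hom (X 0%N) A),
    resolution P d e /\
    match j with
    | 0 => exists c : hom (F (X 0%N)) L, is_cokernel (fmap F (d 0%N)) c
    | i.+1 => is_homology (fmap F (d i.+1)) (fmap F (d i)) L
    end.

Definition right_derived (P : K -> Prop) (F : functor K K) (j : nat) (A R : K) :=
  exists (X : nat -> K) (d : forall j, hom (X j) (X j.+1)) (e : hom A (X 0%N)),
    coresolution P d e /\
    match j with
    | 0 => exists k : hom R (F (X 0%N)), is_kernel (fmap F (d 0%N)) k
    | i.+1 => is_homology (fmap F (d i)) (fmap F (d i.+1)) R
    end.

End Relative.

Section NakayamaNotions.
Variables (A C : abelianCat) (fs : functor A C) (fl : functor C A).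
Variables (adj : adjunction fl fs) (N : nakayama adj).

Definition f_star : functor C A := fcomp (nu N) fl.

Definition relative_projective : A -> Prop := relative_obj fl.

Definition relative_injective : A -> Prop := relative_obj f_star.

Definition gproj : A -> Prop := gorenstein relative_projective (nu N).

Definition ginj : A -> Prop := gorenstein relative_injective (nu_minus N).

Definition derived_vanish_above (n : nat) :=
  forall j, (n < j)%N -> forall X : A,
    (forall L, left_derived relative_projective (nu N) j X L -> is_zero L) /\
    (forall R, right_derived relative_injective (nu_minus N) j X R -> is_zero R).

Definition iwanaga_gorenstein_of_dim (n : nat) :=
  derived_vanish_above n /\
  forall m, derived_vanish_above m -> (n <= m)%N.

End NakayamaNotions.

(* Main.v *)
From mathcomp Require Import all_boot ssralg ssrint.
From Stdlib Require Import ClassicalEpsilon.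
Require Import Defs.
Set Implicit Arguments.
Unset Strict Implicit.
Unset Printing Implicit Defensive.
Import GRing.Theory.
Local Open Scope ring_scope.
Local Open Scope cat_scope.

(** Everything rests on a self-dual part of the data: an adjunction [F] -| [G]
    with classes [P] and [I] of objects exchanged by [F] and [G], on which unit
    and counit are invertible, which cover and cogenerate, and for which the
    derived functors of [F] and [G] vanish in degree 2. Dimension shifting makes
    [F] exact on the sequences Z -> Q -> W with [Q] in [P] and [W] embedded in an
    object of [P]; applied to the start of a coresolution of X, this shows that
    the counit F G X -> X is always mono. So G X = G Y with Y := F G X, a
    quotient of an object of [I], and a coresolution of Y, transported by [G],
    glues with a resolution of G Y to an exact complex that stays exact under
    [F]: every G X is Gorenstein projective, and dually for F X. Since the unit
    is invertible at Gorenstein projectives B, a morphism h : B -> G Y is a split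
    epimorphism as soon as its transpose F B -> Y is, so factorizations of the
    transpose through g yield factorizations of h through G g. *)

(** * Monos, epis, kernels and exactness in preadditive categories *)

Section Preadditive.
Variable K : preaddCat.
Implicit Types A B C D : K.

Lemma comp0m A B C (f : hom A B) : (0 : hom B C) ∘ f = 0.
Proof. by apply: (addrI (0 ∘ f)); rewrite -compDl !addr0. Qed.

Lemma compm0 A B C (g : hom B C) : g ∘ (0 : hom A B) = 0.
Proof. by apply: (addrI (g ∘ 0)); rewrite -compDr !addr0. Qed.

Lemma compBl A B C (g g' : hom B C) (f : hom A B) :
  (g - g') ∘ f = g ∘ f - g' ∘ f.
Proof.
by apply: (addIr (g' ∘ f)); rewrite -compDl !subrK.
Qed.

Lemma epi0 A B (f : hom A B) :
  (forall X (u : hom B X), u ∘ f = 0 -> u = 0) -> epi f.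
Proof.
by move=> f0 X u v fuv; apply/subr0_eq/f0; rewrite compBl fuv subrr.
Qed.

Lemma mono_eq0 A B C (f : hom A B) (u : hom C A) : mono f -> f ∘ u = 0 -> u = 0.
Proof. by move=> fm fu; apply: fm; rewrite fu compm0. Qed.

Lemma epi_eq0 A B C (f : hom A B) (u : hom B C) : epi f -> u ∘ f = 0 -> u = 0.
Proof. by move=> fe uf; apply: fe; rewrite uf comp0m. Qed.

Lemma mono_comp A B C (g : hom B C) (f : hom A B) :
  mono g -> mono f -> mono (g ∘ f).
Proof. by move=> gm fm X u v; rewrite -!compA => /gm/fm. Qed.

Lemma mono_compr A B C (g : hom B C) (f : hom A B) : mono (g ∘ f) -> mono f.
Proof. by move=> gfm X u v fuv; apply: gfm; rewrite -!compA fuv. Qed.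

Lemma epi_comp A B C (g : hom B C) (f : hom A B) :
  epi g -> epi f -> epi (g ∘ f).
Proof. by move=> ge fe X u v; rewrite !compA => /fe/ge. Qed.

Lemma epi_compl A B C (g : hom B C) (f : hom A B) : epi (g ∘ f) -> epi g.
Proof. by move=> gfe X u v ugv; apply: gfe; rewrite !compA ugv. Qed.

Lemma split_mono_mono A B (f : hom A B) : split_mono f -> mono f.
Proof. by move=> [r rf] X u v fuv; rewrite -[u]comp1m -[v]comp1m -rf -!compA fuv. Qed.

Lemma split_epi_epi A B (f : hom A B) : split_epi f -> epi f.
Proof. by move=> [s fs] X u v ufv; rewrite -[u]compm1 -[v]compm1 -fs !compA ufv. Qed.

Lemma iso_mono A B (f : hom A B) : is_iso f -> mono f.
Proof. by move=> [g [gf _]]; apply: split_mono_mono; exists g. Qed.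

Lemma iso_epi A B (f : hom A B) : is_iso f -> epi f.
Proof. by move=> [g [_ fg]]; apply: split_epi_epi; exists g. Qed.

Lemma mono_split_epi_iso A B (f : hom A B) : mono f -> split_epi f -> is_iso f.
Proof.
move=> fm [s fs]; exists s; split=> //; apply: fm.
by rewrite compA fs comp1m compm1.
Qed.

Lemma isomorphic_sym A B : isomorphic A B -> isomorphic B A.
Proof. by move=> [f [g [gf fg]]]; exists g, f. Qed.

Lemma isomorphic_trans A B C : isomorphic A B -> isomorphic B C -> isomorphic A C.
Proof.
move=> [f [f' [f'f ff']]] [g [g' [g'g gg']]]; exists (g ∘ f), (f' ∘ g'); split.
  by rewrite compA -(compA f') g'g compm1.
by rewrite compA -(compA g) ff' compm1.
Qed.

Lemma kernel_mono A B (f : hom A B) X (k : hom X A) : is_kernel f k -> mono k.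
Proof.
move=> [fk kU] Y u v kuv; have fkv : f ∘ (k ∘ v) = 0 by rewrite compA fk comp0m.
by have [w [_ wU]] := kU _ _ fkv; rewrite -(wU u kuv) -(wU v erefl).
Qed.

Lemma kernel_lift A B (f : hom A B) X (k : hom X A) Y (h : hom Y A) :
  is_kernel f k -> f ∘ h = 0 -> exists u, k ∘ u = h.
Proof. by move=> [_ kU] /kU [u [ku _]]; exists u. Qed.

Lemma mono_is_kernel A B (f : hom A B) X (k : hom X A) : mono k ->
  f ∘ k = 0 -> (forall Y (h : hom Y A), f ∘ h = 0 -> exists u, k ∘ u = h) ->
  is_kernel f k.
Proof.
move=> km fk kU; split=> // Y h /kU [u ku]; exists u; split=> // v kv.
by apply: km; rewrite ku kv.
Qed.

Lemma cokernel_epi A B (f : hom A B) X (c : hom B X) : is_cokernel f c -> epi c.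
Proof.
move=> [cf cU] Y u v ucv; have vcf : v ∘ c ∘ f = 0 by rewrite -compA cf compm0.
by have [w [_ wU]] := cU _ _ vcf; rewrite -(wU u ucv) -(wU v erefl).
Qed.

Lemma cokernel_desc A B (f : hom A B) X (c : hom B X) Y (h : hom B Y) :
  is_cokernel f c -> h ∘ f = 0 -> exists u, u ∘ c = h.
Proof. by move=> [_ cU] /cU [u [uc _]]; exists u. Qed.

Lemma epi_is_cokernel A B (f : hom A B) X (c : hom B X) : epi c ->
  c ∘ f = 0 -> (forall Y (h : hom B Y), h ∘ f = 0 -> exists u, u ∘ c = h) ->
  is_cokernel f c.
Proof.
move=> ce cf cU; split=> // Y h /cU [u uc]; exists u; split=> // v vc.
by apply: ce; rewrite uc vc.
Qed.

Lemma is_kernel_iso A B (f : hom A B) X (k : hom X A) Y (a : hom Y X) :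
  is_iso a -> is_kernel f k -> is_kernel f (k ∘ a).
Proof.
move=> ai kk; apply: mono_is_kernel.
- by apply: mono_comp; [apply: kernel_mono kk|apply: iso_mono].
- by rewrite compA kk.1 comp0m.
- move=> Z h /(kernel_lift kk) [u <-]; case: ai => [b [_ ab]].
  by exists (b ∘ u); rewrite compA -(compA k) ab compm1.
Qed.

Lemma is_cokernel_comp_epi A B C (p : hom A B) (f : hom B C) X (c : hom C X) :
  epi p -> is_cokernel f c -> is_cokernel (f ∘ p) c.
Proof.
move=> pe cc; apply: epi_is_cokernel (cokernel_epi cc) _ _.
  by rewrite compA cc.1 comp0m.
by move=> Y h; rewrite compA => /(epi_eq0 pe) /(cokernel_desc cc).
Qed.

Lemma is_kernel_comp_mono A B C (f : hom A B) (n : hom B C) X (k : hom X A) :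
  mono n -> is_kernel f k -> is_kernel (n ∘ f) k.
Proof.
move=> nm kk; apply: mono_is_kernel (kernel_mono kk) _ _.
  by rewrite -compA kk.1 compm0.
by move=> Y h; rewrite -compA => /(mono_eq0 nm) /(kernel_lift kk).
Qed.

Definition short_exact A B C (k : hom A B) (q : hom B C) :=
  is_kernel q k /\ is_cokernel k q.

(** Exactness in a self-dual form: reversing arrows exchanges [p], [m] with [n], [e]. The definition
    of [exact], through a kernel of a cokernel, lacks this symmetry. *)
Definition exact_factorization A B C (f : hom A B) (g : hom B C) :=
  exists I J (p : hom A I) (m : hom I B) (e : hom B J) (n : hom J C),
    [/\ epi p, mono n, short_exact m e, f = m ∘ p & g = n ∘ e].

Lemma exact_factorization_exact A B C (f : hom A B) (g : hom B C) :
  exact_factorization f g -> exact f g.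
Proof.
move=> [I [J [p [m [e [n [pe nm [me em] -> ->]]]]]]].
exists I, m; split; last exact: is_kernel_comp_mono.
by exists J, e; split=> //; apply: is_cokernel_comp_epi.
Qed.

End Preadditive.

(** * Opposite categories, functors and adjunctions *)

Definition op (K : preaddCat) : preaddCat :=
  @PreaddCat K (fun A B => hom B A) (@idm K) (fun _ _ _ g f => f ∘ g)
    (fun _ _ _ _ h g f => esym (compA f g h))
    (fun _ _ f => compm1 f) (fun _ _ f => comp1m f)
    (fun _ _ _ g g' f => compDr f g g') (fun _ _ _ g f f' => compDl f f' g).

Definition op_functor (K L : preaddCat) (F : functor K L) :
    functor (op K) (op L) :=
  @Functor (op K) (op L) F (fun _ _ f => fmap F f) (fmap1 F)
    (fun _ _ _ g f => fmap_comp F f g) (fun _ _ f g => fmapD F f g).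

Definition op_adjunction (K L : preaddCat) (F : functor K L) (G : functor L K)
    (a : adjunction F G) : adjunction (op_functor G) (op_functor F) :=
  @Adjunction (op L) (op K) (op_functor G) (op_functor F)
    (fun B => counit a B) (fun A => unit_ a A)
    (fun _ _ g => esym (counit_nat a g)) (fun _ _ f => esym (unit_nat a f))
    (triangle_r a) (triangle_l a).

Lemma op_abelian (K : preaddCat) : is_abelian K -> is_abelian (op K).
Proof.
move=> [[Z [Z1 Z2]] biprod kercok monoK epiC]; split.
- by exists Z; split.
- move=> A1 A2; have [B [i1 [i2 [p1 [p2 [pi1 pi2 pi12 pi21 ip]]]]]] := biprod A1 A2.
  by exists B, p1, p2, i1, i2; split.
- by move=> A B f; have [[X kX] [Y cY]] := kercok _ _ f; split; [exists Y|exists X].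
- by move=> A B f /epiC [X [g gf]]; exists X, g.
- by move=> A B f /monoK [X [g gf]]; exists X, g.
Qed.

(** * Images and exact sequences in abelian categories *)

Section Abelian.
Variable K : preaddCat.
Hypothesis abK : is_abelian K.
Implicit Types A B C D : K.

Lemma kernel_exists A B (f : hom A B) : exists X (k : hom X A), is_kernel f k.
Proof. by case: abK => _ _ /(_ _ _ f) []. Qed.

Lemma cokernel_exists A B (f : hom A B) :
  exists X (c : hom B X), is_cokernel f c.
Proof. by case: abK => _ _ /(_ _ _ f) []. Qed.

(** [m] is a kernel of some [g], and [g] factors through [c]; so whatever [c] kills is killed by [g]
    and lifts along [m]. *)
Lemma mono_cokernel_short_exact A B C (m : hom A B) (c : hom B C) :
  mono m -> is_cokernel m c -> short_exact m c.
Proof.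
move=> mm mc; split=> //; case: abK => _ _ _ /(_ _ _ _ mm) [X [g gm]] _.
have [g' g'c] := cokernel_desc mc gm.1.
apply: mono_is_kernel => //; first exact: mc.1.
by move=> Y h ch; apply: (kernel_lift gm); rewrite -g'c -compA ch compm0.
Qed.

Lemma mono_short_exact A B (m : hom A B) :
  mono m -> exists C (c : hom B C), short_exact m c.
Proof.
move=> mm; have [C [c mc]] := cokernel_exists m.
by exists C, c; apply: mono_cokernel_short_exact.
Qed.

(** If [w] kills [p], then [p] factors through the kernel [k] of [w]. The mono [m ∘ k] is a kernel
    of some [g], which kills [f], hence factors through [c] and kills [m]. So [m] factors through
    [m ∘ k], which makes [k] a split epimorphism and [w] zero. *)
Lemma image_epi A B (f : hom A B) X (c : hom B X) Y (m : hom Y B)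
    (p : hom A Y) :
  is_cokernel f c -> is_kernel c m -> m ∘ p = f -> epi p.
Proof.
move=> fc cm mp; apply: epi0 => Z w wp.
have [W [k wk]] := kernel_exists w; have km := kernel_mono wk.
have [p' kp'] := kernel_lift wk wp.
have mm := kernel_mono cm.
have [D [g [gmk gU]]] : exists D (g : hom B D), is_kernel g (m ∘ k).
  by case: abK => _ _ _ /(_ _ _ _ (mono_comp mm km)).
have [g' g'c] : exists g', g' ∘ c = g.
  by apply: (cokernel_desc fc); rewrite -mp -kp' !compA -(compA g) gmk comp0m.
have [t mkt] : exists t, m ∘ k ∘ t = m.
  by apply: (kernel_lift (conj gmk gU)); rewrite -g'c -compA cm.1 compm0.
have kt : k ∘ t = idm Y by apply: mm; rewrite compA mkt compm1.
by rewrite -[w]compm1 -kt compA wk.1 comp0m.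
Qed.

Lemma factor_epi_mono A B (f : hom A B) :
  exists Y (m : hom Y B) (p : hom A Y), [/\ mono m, epi p & m ∘ p = f].
Proof.
have [X [c fc]] := cokernel_exists f; have [Y [m cm]] := kernel_exists c.
have [p mp] := kernel_lift cm fc.1; exists Y, m, p; split=> //.
  exact: kernel_mono cm.
exact: image_epi fc cm mp.
Qed.

End Abelian.

Section AbelianExact.
Variable K : preaddCat.
Hypothesis abK : is_abelian K.
Implicit Types A B C D : K.

Lemma epi_kernel_short_exact A B C (k : hom A B) (e : hom B C) :
  epi e -> is_kernel e k -> short_exact k e.
Proof.
move=> ee ek.
by have [] := @mono_cokernel_short_exact (op K) (op_abelian abK) C B A e k ee ek.
Qed.

Lemma epi_short_exact B C (e : hom B C) :
  epi e -> exists A (k : hom A B), short_exact k e.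
Proof.
move=> ee; have [A [k ek]] := kernel_exists abK e.
by exists A, k; apply: epi_kernel_short_exact.
Qed.

Lemma epi_kernel_exact_factorization A B C (f : hom A B) (g : hom B C)
    I (p : hom A I) (m : hom I B) :
  epi p -> is_kernel g m -> m ∘ p = f -> exact_factorization f g.
Proof.
move=> pe gm mp; have [J [n [e [nm ee ne]]]] := factor_epi_mono abK g.
exists I, J, p, m, e, n; split=> //; apply: epi_kernel_short_exact => //.
apply: mono_is_kernel (kernel_mono gm) _ _.
  by apply: (mono_eq0 nm); rewrite compA ne gm.1.
by move=> Y h eh; apply: (kernel_lift gm); rewrite -ne -compA eh compm0.
Qed.

Lemma exactE A B C (f : hom A B) (g : hom B C) :
  exact f g <-> exact_factorization f g.
Proof.
split; last exact: exact_factorization_exact.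
move=> [I [m [[Y [c [fc cm]]] gm]]].
have [p mp] := kernel_lift cm fc.1.
exact: epi_kernel_exact_factorization (image_epi abK fc cm mp) gm mp.
Qed.

(** Turns the vanishing of derived functors into exactness: a zero homology object makes the map
    from [A] to the kernel of [g] an epimorphism. *)
Lemma homology_zero_exact A B C (f : hom A B) (g : hom B C) :
  g ∘ f = 0 -> (forall H, is_homology f g H -> is_zero H) -> exact f g.
Proof.
move=> gf H0; have [X [k gk]] := kernel_exists abK g.
have [u ku] := kernel_lift gk gf; have [H [c uc]] := cokernel_exists abK u.
have [Hz _] : is_zero H by apply: H0; exists X, k, u, c; split.
apply/exactE/(epi_kernel_exact_factorization _ gk ku)/epi0 => Z v vu.
by have [t <-] := cokernel_desc uc vu; rewrite (Hz _ t) comp0m.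
Qed.

Lemma exact_epi_cokernel A B C (f : hom A B) (e : hom B C) :
  exact f e -> epi e -> is_cokernel f e.
Proof.
move=> [I [m [[Y [c [fc cm]]] em]]] ee; have [p mp] := kernel_lift cm fc.1.
rewrite -mp; apply: is_cokernel_comp_epi (image_epi abK fc cm mp) _.
exact: (epi_kernel_short_exact ee em).2.
Qed.

Lemma mono_epi_iso A B (f : hom A B) : mono f -> epi f -> is_iso f.
Proof.
move=> fm fe; have [C [c [fc [cf _]]]] := mono_short_exact abK fm.
apply: mono_split_epi_iso => //; apply: (kernel_lift fc).
by rewrite compm1; apply: epi_eq0 fe cf.
Qed.

End AbelianExact.

Lemma exact_op (K : preaddCat) (A B C : K) (f : hom A B) (g : hom B C) :
  is_abelian K -> @exact (op K) C B A g f <-> exact f g.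
Proof.
move=> abK; rewrite (exactE (op_abelian abK)) (exactE abK).
split=> [] [I [J [p [m [e [n [pe nm [me em] -> ->]]]]]]];
  by exists J, I, n, e, m, p; split.
Qed.

Lemma exact_comp0 (K : preaddCat) (A B C : K) (f : hom A B) (g : hom B C) :
  exact f g -> g ∘ f = 0.
Proof.
move=> [I [m [[Y [c [fc cm]]] gm]]]; have [p <-] := kernel_lift cm fc.1.
by rewrite compA gm.1 comp0m.
Qed.

(** * Additive functors and adjunctions *)

Section Functors.
Variables K L : preaddCat.

Lemma fmap0 (F : functor K L) (A B : K) : fmap F (0 : hom A B) = 0.
Proof. by apply: (addrI (fmap F 0)); rewrite -fmapD !addr0. Qed.

Lemma fmap_iso (F : functor K L) (A B : K) (f : hom A B) :
  is_iso f -> is_iso (fmap F f).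
Proof.
by move=> [g [gf fg]]; exists (fmap F g); rewrite -!fmap_comp gf fg !fmap1.
Qed.

Lemma fmap_split_epi (F : functor K L) (A B : K) (f : hom A B) :
  split_epi f -> split_epi (fmap F f).
Proof. by move=> [s fs]; exists (fmap F s); rewrite -fmap_comp fs fmap1. Qed.

Lemma fmap_direct_summand (F : functor K L) (A B : K) :
  direct_summand A B -> direct_summand (F A) (F B).
Proof.
move=> [A' [i1 [i2 [p1 [p2 [pi1 pi2 pi12 pi21 ip]]]]]].
exists (F A'), (fmap F i1), (fmap F i2), (fmap F p1), (fmap F p2).
by split; rewrite -!fmap_comp -?fmapD ?pi1 ?pi2 ?pi12 ?pi21 ?ip ?fmap1 ?fmap0.
Qed.

End Functors.

Section LeftAdjoint.
Variables (K L : preaddCat) (F : functor K L) (G : functor L K).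
Variable a : adjunction F G.

Lemma transpose_inj (A : K) (B : L) (u v : hom (F A) B) :
  fmap G u ∘ unit_ a A = fmap G v ∘ unit_ a A -> u = v.
Proof.
move=> uv; rewrite -[u]compm1 -[v]compm1 -(triangle_l a) !compA -!counit_nat.
by rewrite -!compA -!fmap_comp uv.
Qed.

Lemma transposeK (A : K) (B : L) (h : hom A (G B)) :
  fmap G (counit a B ∘ fmap F h) ∘ unit_ a A = h.
Proof. by rewrite fmap_comp -compA -unit_nat compA triangle_r comp1m. Qed.

Lemma left_adjoint_epi (A B : K) (e : hom A B) : epi e -> epi (fmap F e).
Proof.
move=> ee X u v uv; apply/transpose_inj/ee.
by rewrite -!compA !unit_nat !compA -!fmap_comp uv.
Qed.

Lemma left_adjoint_cokernel (A B : K) (f : hom A B) C (c : hom B C) :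
  is_cokernel f c -> is_cokernel (fmap F f) (fmap F c).
Proof.
move=> cc; apply: epi_is_cokernel.
- exact/left_adjoint_epi/(cokernel_epi cc).
- by rewrite -fmap_comp cc.1 fmap0.
move=> Y h hf; have [|t tc] := @cokernel_desc _ _ _ _ _ _ _ (fmap G h ∘ unit_ a B) cc.
  by rewrite -compA unit_nat compA -fmap_comp hf fmap0 comp0m.
exists (counit a Y ∘ fmap F t); apply: transpose_inj.
by rewrite -compA -fmap_comp tc transposeK.
Qed.

End LeftAdjoint.

Section RightAdjoint.
Variables (K L : preaddCat) (F : functor K L) (G : functor L K).
Variable a : adjunction F G.

(** Monos and kernels are by conversion the epis and cokernels of the opposite category, so the
    statements on left adjoints apply to [op_adjunction a]. *)
Lemma right_adjoint_mono (A B : L) (m : hom A B) : mono m -> mono (fmap G m).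
Proof. exact: (left_adjoint_epi (op_adjunction a)). Qed.

Lemma right_adjoint_kernel (A B : L) (f : hom A B) X (k : hom X A) :
  is_kernel f k -> is_kernel (fmap G f) (fmap G k).
Proof. exact: (left_adjoint_cokernel (op_adjunction a)). Qed.

End RightAdjoint.

(** By naturality the unit at [A] is a retract of the unit at [B], so the inverse at [B] restricts
    to one at [A]. *)
Lemma unit_iso_retract (K L : preaddCat) (F : functor K L) (G : functor L K)
    (a : adjunction F G) (A B : K) (i : hom A B) (p : hom B A) :
  p ∘ i = idm A -> is_iso (unit_ a B) -> is_iso (unit_ a A).
Proof.
move=> pi [g [gu ug]]; exists (p ∘ g ∘ fmap G (fmap F i)); split.
  by rewrite -compA -unit_nat -compA (compA g) gu comp1m.
rewrite !compA unit_nat -(compA _ _ g) ug compm1.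
by rewrite -!fmap_comp pi !fmap1.
Qed.

(** * Iterated syzygies and resolutions *)

Section Syzygies.
Variables (K : preaddCat) (P : K -> Prop).

(** Kept as data rather than as an existential, so that one choice of a cover for every object
    permits recursion on syzygies. *)
Record syzygy (Z : K) := Syzygy {
  cover : K;
  syz : K;
  syz_incl : hom syz cover;
  cover_proj : hom cover Z;
  coverP : P cover;
  syzP : short_exact syz_incl cover_proj
}.

Lemma syzygy_choice : is_abelian K ->
  (forall Z, exists (Q : K) (p : hom Q Z), P Q /\ epi p) ->
  inhabited (forall Z, syzygy Z).
Proof.
move=> abK cov; have sZ Z : inhabited (syzygy Z).
  have [Q [p [PQ pe]]] := cov Z.
  have [S [k kp]] := epi_short_exact abK pe.
  by split; exists Q S k p.
by split=> Z; apply: epsilon (sZ Z) (fun=> True).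
Qed.

Variable c : forall Z, syzygy Z.

Fixpoint iter_syz (Z : K) (n : nat) : K :=
  if n is m.+1 then syz (c (iter_syz Z m)) else Z.

Definition syz_res (Z : K) (n : nat) : K := cover (c (iter_syz Z n)).

Definition syz_diff (Z : K) (n : nat) : hom (syz_res Z n.+1) (syz_res Z n) :=
  syz_incl (c (iter_syz Z n)) ∘ cover_proj (c (iter_syz Z n.+1)).

Lemma syz_resolution (Z : K) :
  resolution P (syz_diff Z) (cover_proj (c Z)).
Proof.
split.
- by move=> j; apply: coverP.
- exact: cokernel_epi (syzP _).2.
- apply: exact_factorization_exact.
  exists (iter_syz Z 1), Z, (cover_proj (c (iter_syz Z 1))), (syz_incl (c Z)).
  exists (cover_proj (c Z)), (idm Z); rewrite comp1m; split=> //.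
  + exact: cokernel_epi (syzP _).2.
  + by move=> X u v; rewrite !comp1m.
  + exact: syzP.
- move=> j; apply: exact_factorization_exact.
  exists (iter_syz Z j.+2), (iter_syz Z j.+1).
  exists (cover_proj (c _)), (syz_incl (c _)), (cover_proj (c _)).
  exists (syz_incl (c _)); split=> //.
  + exact: cokernel_epi (syzP _).2.
  + exact: kernel_mono (syzP _).1.
  + exact: syzP.
Qed.

End Syzygies.

Section Extension.
Variables (K : preaddCat) (P : K -> Prop).
Variables (V W Z Q0 Q1 : K) (w : hom W Q0) (v : hom Q0 V) (k : hom Z Q1)
  (q : hom Q1 W).
Hypotheses (wv : short_exact w v) (kq : short_exact k q).
Variables (X : nat -> K) (d : forall j, hom (X j.+1) (X j)) (e : hom (X 0%N) Z).

(** Degrees move up by two: the homology in degree 2 for [V] is taken between [d 0] and [k ∘ e]. *)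
Definition extend_obj (n : nat) : K :=
  match n with 0 => Q0 | 1 => Q1 | m.+2 => X m end.

Definition extend_diff (n : nat) : hom (extend_obj n.+1) (extend_obj n) :=
  match n with 0 => w ∘ q | 1 => k ∘ e | m.+2 => d m end.

Lemma extend_resolution :
  is_abelian K -> P Q0 -> P Q1 -> resolution P d e ->
  @resolution K P V extend_obj extend_diff v.
Proof.
move=> abK PQ0 PQ1 [PX ee de dd].
have [[qe wm] [ve km]] := ((cokernel_epi kq.2, kernel_mono wv.1),
  (cokernel_epi wv.2, kernel_mono kq.1)).
split=> //.
- by case=> [|[|j]] /=.
- apply: exact_factorization_exact.
  exists W, V, q, w, v, (idm V); rewrite comp1m; split=> //.
  by move=> Y s t; rewrite !comp1m.
- case=> [|[|j]]; last exact: dd.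
    apply: exact_factorization_exact.
    by exists Z, W, e, k, q, w.
  move: de => /= /(exactE abK) [I [J [p [m [e' [n [pe nm me -> ee']]]]]]].
  apply: exact_factorization_exact.
  exists I, J, p, m, e', (k ∘ n); split=> //=; first exact: mono_comp.
  by rewrite ee' compA.
Qed.

End Extension.

(** The symmetric part of the data of a Nakayama functor: reversing arrows
    exchanges [F] with [G] and [P] with [I]. *)
Record nakayama_setting (K : preaddCat) (F G : functor K K)
    (a : adjunction F G) (P I : K -> Prop) : Prop := NakayamaSetting {
  ns_abelian : is_abelian K;
  ns_cover : forall X, exists (Q : K) (p : hom Q X), P Q /\ epi p;
  ns_embed : forall X, exists (J : K) (i : hom X J), I J /\ mono i;
  ns_unit : forall Q, P Q -> is_iso (unit_ a Q);
  ns_counit : forall J, I J -> is_iso (counit a J);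
  ns_F : forall Q, P Q -> I (F Q);
  ns_G : forall J, I J -> P (G J);
  ns_left : forall V X d e, @resolution K P V X d e ->
    exact (fmap F (d 2)) (fmap F (d 1));
  ns_right : forall V X d e, @coresolution K I V X d e ->
    exact (fmap G (d 1)) (fmap G (d 2))
}.

Lemma is_iso_op (K : preaddCat) (A B : K) (f : hom A B) :
  is_iso f -> @is_iso (op K) B A f.
Proof. by move=> [g [gf fg]]; exists g. Qed.

Lemma op_nakayama_setting (K : preaddCat) (F G : functor K K)
    (a : adjunction F G) (P I : K -> Prop) :
  nakayama_setting a P I -> nakayama_setting (op_adjunction a) I P.
Proof.
move=> [abK cov emb uP cI FP GI lft rgt]; split=> //.
- exact: op_abelian.
- by move=> J /cI; apply: is_iso_op.
- by move=> Q /uP; apply: is_iso_op.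
- move=> V X d e [PX ee de dd]; apply/(exact_op _ _ abK)/(rgt V X d e).
  by split=> // [|j]; apply/(exact_op _ _ abK).
- move=> V X d e [PX ee de dd]; apply/(exact_op _ _ abK)/(lft V X d e).
  by split=> // [|j]; apply/(exact_op _ _ abK).
Qed.

(** * Dimension shifting and the counit *)

Section Setting.
Variables (K : preaddCat) (F G : functor K K) (a : adjunction F G).
Variables (P I : K -> Prop).
Hypothesis S : nakayama_setting a P I.
Let abK := ns_abelian S.

(* Prolonging [Z -> Q -> Q'] to a resolution of the cokernel of [w], the
   vanishing in degree 2 for that cokernel is the vanishing in degree 1 for
   [W]. *)
Lemma left_short_exact (Z Q W Q' : K) (k : hom Z Q) (q : hom Q W) (w : hom W Q') :
  short_exact k q -> P Q -> mono w -> P Q' -> short_exact (fmap F k) (fmap F q).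
Proof.
move=> kq PQ wm PQ'; have Fkq := left_adjoint_cokernel a kq.2.
apply: mono_cokernel_short_exact => //.
have [V [v wv]] := mono_short_exact abK wm.
have [c] := syzygy_choice abK (ns_cover S).
have rZ := syz_resolution c Z.
have := ns_left S (extend_resolution wv kq abK PQ' PQ rZ).
rewrite /= fmap_comp => /(exactE abK) [J [L [p [m [e [n [pe nm me dE kE]]]]]]].
have [_ _ de _] := rZ.
set e0 := cover_proj _ in kE de *; set d0 := syz_diff _ _ _ in dE de.
have ed0 : is_cokernel d0 e0.
  by apply: (exact_epi_cokernel abK de (cokernel_epi (syzP _).2)).
(* [e] and [fmap F e0] are both cokernels of [fmap F d0], so [t] has the left inverse [s]; then
   [fmap F k] is [n ∘ t], a composite of monos. *)
have Fed := left_adjoint_cokernel a ed0.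
have ed : e ∘ fmap F d0 = 0 by rewrite dE compA me.2.1 comp0m.
have [t te] := cokernel_desc Fed ed.
have [s se] : exists s, s ∘ e = fmap F e0.
  apply: (cokernel_desc me.2); apply: (epi_eq0 pe).
  by rewrite -compA -dE -fmap_comp ed0.1 fmap0.
have st : s ∘ t = idm _.
  by apply: (cokernel_epi Fed); rewrite -compA te se comp1m.
have -> : fmap F k = n ∘ t.
  by apply: (cokernel_epi Fed); rewrite kE -compA te.
by apply: mono_comp => //; apply: split_mono_mono; exists s.
Qed.

(** Naturality reduces the claim to [fmap F (fmap G i)] being mono, for [i] embedding [X] into an
    object of [I]. Two steps of a coresolution put [fmap G i] into a short exact sequence to which
    [left_short_exact] applies: its last term [W], the image of [fmap G (j ∘ c)], embeds in an
    object of [P]. *)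
Lemma counit_mono (X : K) : mono (counit a X).
Proof.
have [J0 [i [IJ0 im]]] := ns_embed S X.
have [X1 [c ic]] := mono_short_exact abK im.
have [J1 [j [IJ1 jm]]] := ns_embed S X1.
have Gi := right_adjoint_kernel a (is_kernel_comp_mono jm ic.1).
have [W [n [e [nm ee ne]]]] := factor_epi_mono abK (fmap G (j ∘ c)).
have ike : short_exact (fmap G i) e.
  apply: epi_kernel_short_exact => //.
  apply: mono_is_kernel (kernel_mono Gi) _ _.
    by apply: (mono_eq0 nm); rewrite compA ne Gi.1.
  by move=> Y h eh; apply: (kernel_lift Gi); rewrite -ne -compA eh compm0.
have FGi := left_short_exact ike (ns_G S IJ0) nm (ns_G S IJ1).
apply: (@mono_compr _ _ _ _ i); rewrite -counit_nat; apply: mono_comp.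
  exact/iso_mono/(ns_counit S).
exact: kernel_mono FGi.1.
Qed.

End Setting.

(** * Gorenstein objects and complete resolutions *)

Section Gorenstein.
Variables (K : preaddCat) (P : K -> Prop) (F : functor K K).

(** Splicing gives the differentials [k (predz i) ∘ q i], and [k 0] is a kernel of the one in degree
    0 since [k (predz 0)] is mono. *)
Lemma short_exact_family_gorenstein (Z Q : int -> K)
    (k : forall i, hom (Z i) (Q i)) (q : forall i, hom (Q i) (Z (predz i))) :
  (forall i, P (Q i)) -> (forall i, short_exact (k i) (q i)) ->
  (forall i, short_exact (fmap F (k i)) (fmap F (q i))) ->
  gorenstein P F (Z 0).
Proof.
move=> PQ kq Fkq; exists Q, (fun i => k (predz i) ∘ q i); split=> //.
- move=> i; apply: exact_factorization_exact.
  exists (Z (predz i)), (Z (predz (predz i))), (q i), (k _), (q _), (k _).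
  split=> //; first exact: cokernel_epi (kq i).2.
  exact: kernel_mono (kq _).1.
- move=> i; apply: exact_factorization_exact.
  exists (F (Z (predz i))), (F (Z (predz (predz i)))).
  exists (fmap F (q i)), (fmap F (k _)), (fmap F (q _)), (fmap F (k _)).
  split; rewrite ?fmap_comp //; first exact: cokernel_epi (Fkq i).2.
  exact: kernel_mono (Fkq _).1.
- exists (k 0); apply: is_kernel_comp_mono (kernel_mono (kq _).1) (kq _).1.
Qed.

Lemma gorenstein_isomorphic (A B : K) :
  isomorphic A B -> gorenstein P F B -> gorenstein P F A.
Proof.
move=> [f fi] [X [d [PX dX FdX [k dk]]]]; exists X, d; split=> //.
by exists (k ∘ f); apply: is_kernel_iso.
Qed.

Lemma gorenstein_embeds (A : K) : gorenstein P F A ->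
  exists (Q : K) (i : hom A Q), P Q /\ mono i.
Proof.
move=> [X [d [PX _ _ [k dk]]]]; exists (X 0), k; split=> //.
exact: kernel_mono dk.
Qed.

(** [A] is the kernel of [d 0], hence by exactness the image of [d 1], so [X 1] maps onto it. The
    maps [s] and [t] identify the two kernels [k] and [m] of [d 0]. *)
Lemma gorenstein_quotient (A : K) : is_abelian K -> gorenstein P F A ->
  exists (Q : K) (p : hom Q A), P Q /\ epi p.
Proof.
move=> abK [X [d [PX dX _ [k dk]]]].
move: (dX 1) => /(exactE abK) [J [L [p [m [e [n [pe nm me _ dE]]]]]]].
have em : is_kernel (d 0) m by rewrite [d 0]dE; apply: is_kernel_comp_mono me.1.
have [s ms] := kernel_lift em dk.1; have [t kt] := kernel_lift dk em.1.
have ts : t ∘ s = idm A.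
  by apply: (kernel_mono dk); rewrite compA kt ms compm1.
exists (X 1), (t ∘ p); split=> //; apply: epi_comp pe.
by apply: split_epi_epi; exists s.
Qed.

End Gorenstein.

Section CompleteResolution.
Variables (K : preaddCat) (F G : functor K K) (a : adjunction F G).
Variables (P I : K -> Prop).
Hypothesis S : nakayama_setting a P I.

Lemma right_short_exact (J' Y J Y' : K) (w : hom J' Y) (k : hom Y J)
    (q : hom J Y') :
  short_exact k q -> I J -> epi w -> I J' -> short_exact (fmap G k) (fmap G q).
Proof.
move=> [qk kq] IJ we IJ'; have [] := @left_short_exact _ _ _ _ _ _
  (op_nakayama_setting S) Y' J Y J' q k w (conj kq qk) IJ we IJ'.
by split.
Qed.

Lemma unit_epi (X : K) : epi (unit_ a X).
Proof. exact: (counit_mono (op_nakayama_setting S)). Qed.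

Variables (c : forall Z, syzygy P Z) (c' : forall Y, @syzygy (op K) I Y).
Variable Y : K.

Definition cosyz (n : nat) : K := @iter_syz (op K) I c' Y n.
Definition hull (n : nat) : K := cover (c' (cosyz n)).
Definition hull_incl (n : nat) : hom (cosyz n) (hull n) :=
  cover_proj (c' (cosyz n)).
Definition cosyz_proj (n : nat) : hom (hull n) (cosyz n.+1) :=
  syz_incl (c' (cosyz n)).

(** The syzygies of [G Y] in degrees [>= 0], and [G] applied to the cosyzygies
    of [Y] in degrees [< 0]. *)
Definition complete_syz (i : int) : K :=
  match i with
  | Posz n => iter_syz c (G Y) n
  | Negz n => G (cosyz n.+1)
  end.

(** The seam lies at the syzygy [G Y] of degree 0: as [G (cosyz 0)] it embeds in [G (hull 0)], and
    its chosen cover stands in degree 1. *)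
Definition complete_cover (i : int) : K :=
  match i with
  | Posz 0 => G (hull 0)
  | Posz n.+1 => cover (c (iter_syz c (G Y) n))
  | Negz n => G (hull n.+1)
  end.

Definition complete_incl (i : int) : hom (complete_syz i) (complete_cover i) :=
  match i with
  | Posz 0 => fmap G (hull_incl 0)
  | Posz n.+1 => syz_incl (c (iter_syz c (G Y) n))
  | Negz n => fmap G (hull_incl n.+1)
  end.

Definition complete_proj (i : int) :
    hom (complete_cover i) (complete_syz (predz i)) :=
  match i with
  | Posz 0 => fmap G (cosyz_proj 0)
  | Posz n.+1 => cover_proj (c (iter_syz c (G Y) n))
  | Negz n => fmap G (cosyz_proj n.+1)
  end.

Lemma hullP n : I (hull n).
Proof. exact: (coverP (c' (cosyz n))). Qed.

Lemma cosyz_short_exact n : short_exact (hull_incl n) (cosyz_proj n).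
Proof. by have [] := syzP (c' (cosyz n)). Qed.

Lemma complete_coverP i : P (complete_cover i).
Proof.
case: i => [[|n]|n] /=; last exact/(ns_G S)/hullP.
- exact/(ns_G S)/hullP.
- exact: coverP.
Qed.

Variables (J : K) (p : hom J Y).
Hypotheses (IJ : I J) (pe : epi p).

Lemma G_cosyz_short_exact n :
  short_exact (fmap G (hull_incl n)) (fmap G (cosyz_proj n)).
Proof.
have h := cosyz_short_exact n.
(* For [n = 0] the epimorphism onto [Y] that [right_short_exact] asks for is [p]; afterwards it is
   the projection from the previous hull. *)
case: n h => [|n] h; first exact: right_short_exact h (hullP _) pe IJ.
apply: right_short_exact h (hullP _) _ (hullP n).
exact: cokernel_epi (cosyz_short_exact n).2.
Qed.

Lemma complete_short_exact i :
  short_exact (complete_incl i) (complete_proj i).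
Proof.
case: i => [[|n]|n] /=; last exact: G_cosyz_short_exact.
- exact: G_cosyz_short_exact.
- exact: syzP.
Qed.

Lemma F_complete_short_exact i :
  short_exact (fmap F (complete_incl i)) (fmap F (complete_proj i)).
Proof.
apply: (left_short_exact S (complete_short_exact i) (complete_coverP i) _
  (complete_coverP (predz i))).
exact: kernel_mono (complete_short_exact _).1.
Qed.

(** [right_short_exact] needs an epimorphism from an object of [I] onto [F (complete_syz i)]: [F]
    applied to the chosen cover of [complete_syz i] provides it. *)
Lemma GF_complete_short_exact i :
  short_exact (fmap G (fmap F (complete_incl i)))
    (fmap G (fmap F (complete_proj i))).
Proof.
apply: (right_short_exact (F_complete_short_exact i)
  (ns_F S (complete_coverP i)) _ (ns_F S (coverP (c (complete_syz i))))).
exact: (left_adjoint_epi a (cokernel_epi (syzP (c (complete_syz i))).2)).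
Qed.

End CompleteResolution.

Section GorensteinImages.
Variables (K : preaddCat) (F G : functor K K) (a : adjunction F G).
Variables (P I : K -> Prop).
Hypothesis S : nakayama_setting a P I.
Let abK := ns_abelian S.

(** One complete resolution serves both claims: it has syzygy [G Y] in degree 0 and stays exact
    under [F]; its image under [F] consists of objects of [I] and stays exact under [G]. *)
Lemma quotient_gorenstein (J Y : K) (p : hom J Y) : I J -> epi p ->
  gorenstein P F (G Y) /\ gorenstein I G (F (G Y)).
Proof.
move=> IJ pe; have [c] := syzygy_choice abK (ns_cover S).
have [c'] := syzygy_choice (op_abelian abK) (ns_cover (op_nakayama_setting S)).
split.
  apply: (short_exact_family_gorenstein (complete_coverP S c c' Y)
    (complete_short_exact S c c' IJ pe)).
  exact: (F_complete_short_exact S c c' IJ pe).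
apply: (@short_exact_family_gorenstein _ _ _ (fun i => F (complete_syz G c c' Y i))
  (fun i => F (complete_cover G c c' Y i))
  (fun i => fmap F (complete_incl G c c' Y i))
  (fun i => fmap F (complete_proj G c c' Y i))).
- by move=> i; apply: (ns_F S (complete_coverP S c c' Y i)).
- exact: (F_complete_short_exact S c c' IJ pe).
- exact: (GF_complete_short_exact S c c' IJ pe).
Qed.

Lemma F_quotient (X : K) : exists (J : K) (p : hom J (F X)), I J /\ epi p.
Proof.
have [Q [p [PQ pe]]] := ns_cover S X; exists (F Q), (fmap F p).
by split; [apply: (ns_F S PQ)|apply: (left_adjoint_epi a pe)].
Qed.

Lemma counit_F_iso (X : K) : is_iso (counit a (F X)).
Proof.
apply: mono_split_epi_iso; first exact: (counit_mono S).
by exists (fmap F (unit_ a X)); apply: triangle_l.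
Qed.

Lemma G_gorenstein (X : K) : gorenstein P F (G X).
Proof.
have [J [p [IJ pe]]] := F_quotient (G X).
apply: (gorenstein_isomorphic _ (quotient_gorenstein IJ pe).1).
apply: isomorphic_sym; exists (fmap G (counit a X)).
apply: mono_split_epi_iso; first exact/(right_adjoint_mono a)/(counit_mono S).
by exists (unit_ a (G X)); apply: triangle_r.
Qed.

(** [F X] is itself a quotient of an object of [I], so [F (G (F X))] is Gorenstein, and the counit
    identifies it with [F X]. *)
Lemma F_gorenstein (X : K) : gorenstein I G (F X).
Proof.
have [J [p [IJ pe]]] := F_quotient X.
apply: (gorenstein_isomorphic _ (quotient_gorenstein IJ pe).2).
by apply: isomorphic_sym; exists (counit a (F X)); apply: counit_F_iso.
Qed.

(** The unit is epi everywhere; naturality along [i] compares it with the invertible unit at [Q],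
    which makes it mono. *)
Lemma mono_unit_iso (B Q : K) (i : hom B Q) :
  P Q -> mono i -> is_iso (unit_ a B).
Proof.
move=> PQ im; apply: mono_epi_iso => //; last exact: (unit_epi S).
apply: (@mono_compr _ _ _ _ (fmap G (fmap F i))); rewrite -unit_nat.
by apply: mono_comp => //; apply/iso_mono/(ns_unit S).
Qed.

Lemma epi_counit_iso (B J : K) (p : hom J B) :
  I J -> epi p -> is_iso (counit a B).
Proof.
move=> IJ pe; apply: mono_epi_iso => //; first exact: (counit_mono S).
apply: (@epi_compl _ _ _ _ _ (fmap F (fmap G p))); rewrite counit_nat.
by apply: epi_comp => //; apply/iso_epi/(ns_counit S).
Qed.

Lemma gorenstein_unit_iso (B : K) : gorenstein P F B -> is_iso (unit_ a B).
Proof.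
by move=> /gorenstein_embeds [Q [i [PQ im]]]; apply: mono_unit_iso PQ im.
Qed.

Lemma gorenstein_counit_iso (B : K) : gorenstein I G B -> is_iso (counit a B).
Proof.
by move=> /(gorenstein_quotient abK) [J [p [IJ pe]]]; apply: epi_counit_iso IJ pe.
Qed.

End GorensteinImages.

(** * Almost split morphisms under adjoint functors *)

Lemma right_adjoint_right_almost_split (K : preaddCat) (F G : functor K K)
    (a : adjunction F G) (T : K -> Prop) (X Y : K) (g : hom X Y) :
  (forall Z, T (G Z)) -> (forall B, T B -> is_iso (unit_ a B)) ->
  right_almost_split g ->
  split_epi (fmap G g) \/ right_almost_split_in T (fmap G g).
Proof.
move=> TG Tunit [_ gU]; have [|Gg] := classic (split_epi (fmap G g)); first by left.
right; exists (TG X), (TG Y); split=> // -[B TB] /= h hns.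
have /gU [k gk] : ~ split_epi (counit a Y ∘ fmap F h).
  (* [h] is [G] of its transpose after the unit at [B], whose inverse is [r]; so a section [s] of
     [G] of the transpose gives the section [r ∘ s] of [h]. *)
  move=> /(fmap_split_epi G) [s hs]; apply: hns.
  have [r [_ ur]] := Tunit B TB.
  exists (r ∘ s) => /=; rewrite -[h](transposeK a) -compA (compA _ r) ur comp1m.
  exact: hs.
by exists (fmap G k ∘ unit_ a B); rewrite /= compA -fmap_comp gk transposeK.
Qed.

Lemma left_adjoint_left_almost_split (K : preaddCat) (F G : functor K K)
    (a : adjunction F G) (T : K -> Prop) (X Y : K) (g : hom X Y) :
  (forall Z, T (F Z)) -> (forall B, T B -> is_iso (counit a B)) ->
  left_almost_split g ->
  split_mono (fmap F g) \/ left_almost_split_in T (fmap F g).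
Proof.
move=> TF Tcounit gas.
have Tunit (B : op K) : T B -> is_iso (unit_ (op_adjunction a) B).
  by move=> /Tcounit; apply: is_iso_op.
have [|[TY [TX Fg]]] := @right_adjoint_right_almost_split _ _ _
  (op_adjunction a) T Y X g TF Tunit gas; first by left.
by right; exists TX, TY.
Qed.

(** * Relative objects and the data of a Nakayama functor *)

Lemma relative_obj_fmap (K L M : preaddCat) (H : functor L K) (F : functor K M)
    (A : K) :
  relative_obj H A -> relative_obj (fcomp F H) (F A).
Proof.
move=> [B [[X [f fi]] AB]]; exists (F B).
by split; [exists X, (fmap F f); apply: fmap_iso|apply: fmap_direct_summand].
Qed.

Lemma relative_obj_isomorphic (K L : preaddCat) (H H' : functor L K) (A : K) :
  (forall X, isomorphic (H' X) (H X)) -> relative_obj H A -> relative_obj H' A.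
Proof.
move=> HH' [B [[X XB] AB]]; exists B; split=> //; exists X.
exact: isomorphic_trans (HH' X) XB.
Qed.

Lemma relative_obj_refl (K L : preaddCat) (H : functor L K) (X : L) :
  is_abelian K -> relative_obj H (H X).
Proof.
move=> [[Z [Z1 Z2]] _ _ _ _]; exists (H X); split.
  by exists X, (idm _), (idm _); rewrite comp1m.
exists Z, (idm _), 0, (idm _), 0.
by split; rewrite ?comp1m ?comp0m ?addr0 ?(Z1 _ (idm Z)).
Qed.

Lemma relative_obj_retract (K L : preaddCat) (H : functor L K) (A : K) :
  relative_obj H A ->
  exists X (i : hom A (H X)) (p : hom (H X) A), p ∘ i = idm A.
Proof.
move=> [B [[X [f [g [gf fg]]]] [A' [i [_ [p [_ [pi _ _ _ _]]]]]]]].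
by exists X, (g ∘ i), (p ∘ f); rewrite compA -(compA p) fg compm1.
Qed.

Lemma unit_iso_relative_obj (K L : preaddCat) (F G : functor K K)
    (a : adjunction F G) (H : functor L K) (A : K) :
  (forall X, is_iso (unit_ a (H X))) -> relative_obj H A -> is_iso (unit_ a A).
Proof.
by move=> uH /relative_obj_retract [X [i [p /unit_iso_retract]]]; apply.
Qed.

Lemma counit_iso_relative_obj (K L : preaddCat) (F G : functor K K)
    (a : adjunction F G) (H : functor L K) (A : K) :
  (forall X, is_iso (counit a (H X))) -> relative_obj H A ->
  is_iso (counit a A).
Proof.
move=> cH /relative_obj_retract [X [i [p pi]]]; apply: (@is_iso_op (op K)).
apply: (@unit_iso_retract _ _ _ _ (op_adjunction a) A (H X) p i pi).
exact/is_iso_op/cH.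
Qed.

Lemma nakayama_settingP (A C : abelianCat) (fs : functor A C)
    (fl : functor C A) (adj : adjunction fl fs) (N : nakayama adj) :
  faithful fs -> derived_vanish_above N 1 ->
  nakayama_setting (nu_adj N) (relative_projective fl) (relative_injective N).
Proof.
move=> fs_faithful van; have abA := abcatP A.
have [radj] := nu_right_adj N.
have ul (X : C) : is_iso (unit_ (nu_adj N) (fl X)) by apply: nu_unit_iso.
split=> //.
- move=> X; exists (fl (fs X)), (counit adj X); split.
    exact: relative_obj_refl.
  (* A triangle identity splits the counit after applying [fs], and a faithful functor reflects
     epimorphisms. *)
  move=> Y u v uv; apply: fs_faithful.
  have ss : split_epi (fmap fs (counit adj X)).
    by exists (unit_ adj (fs X)); apply: triangle_r.
  by apply: (split_epi_epi ss); rewrite -!fmap_comp uv.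
- move=> X; exists (f_star N (fs X)), (unit_ radj X); split.
    exact: relative_obj_refl.
  move=> Y u v uv; apply: fs_faithful.
  have ss : split_mono (fmap fs (unit_ radj X)).
    by exists (counit radj (fs X)); apply: triangle_l.
  by apply: (split_mono_mono ss); rewrite -!fmap_comp uv.
- by move=> Q; apply: unit_iso_relative_obj.
(* On the image of [f_star] the counit is inverse to [nu] of the unit, which is invertible by
   [nu_unit_iso]; retracts inherit this. *)
- move=> J; apply: counit_iso_relative_obj => X /=.
  apply: mono_split_epi_iso; last first.
    by exists (fmap (nu N) (unit_ (nu_adj N) (fl X))); apply: triangle_l.
  have [v [vu uv]] := fmap_iso (nu N) (ul X).
  apply: split_mono_mono; exists (fmap (nu N) (unit_ (nu_adj N) (fl X))).
  have -> : counit (nu_adj N) (nu N (fl X)) = v.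
    by rewrite -[LHS]compm1 -uv compA triangle_l comp1m.
  exact: uv.
- by move=> Q; apply: relative_obj_fmap.
(* [nu_minus N] sends [J] to a summand of some [nu_minus N (nu N (fl X))] up to isomorphism, and the
   unit identifies that object with [fl X]. *)
- move=> J /(relative_obj_fmap (nu_minus N)).
  by apply: relative_obj_isomorphic => X; exists (unit_ (nu_adj N) (fl X)).
- move=> V X d e res; have [_ _ _ dd] := res; apply: homology_zero_exact => //.
    by rewrite -fmap_comp (exact_comp0 (dd 1%N)) fmap0.
  move=> H HH; apply: (van 2 isT V).1; exists X, d, e; by split.
- move=> V X d e res; have [_ _ _ dd] := res; apply: homology_zero_exact => //.
    by rewrite -fmap_comp (exact_comp0 (dd 1%N)) fmap0.
  move=> H HH; apply: (van 2 isT V).2; exists X, d, e; by split.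
Qed.

Theorem corollary6p13 (A C : abelianCat) (fs : functor A C) (fl : functor C A)
    (adj : adjunction fl fs) (fs_faithful : faithful fs) (N : nakayama adj)
    (n : nat) (IG : iwanaga_gorenstein_of_dim N n) (n_le1 : (n <= 1)%N)
    (X Y : A) (g : hom X Y) :
  (right_almost_split g ->
     split_epi (fmap (nu_minus N) g) \/
     right_almost_split_in (gproj N) (fmap (nu_minus N) g)) /\
  (left_almost_split g ->
     split_mono (fmap (nu N) g) \/
     left_almost_split_in (ginj N) (fmap (nu N) g)).
Proof.
(* As [n] is at most 1, vanishing above [n] gives vanishing above 1, in particular in degree 2,
   where dimension shifting uses it. *)
have van : derived_vanish_above N 1.
  by move=> j lt1j; apply: IG.1; apply: leq_ltn_trans lt1j.
have S := nakayama_settingP fs_faithful van; split.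
- apply: (right_adjoint_right_almost_split (G_gorenstein S)).
  exact: gorenstein_unit_iso S.
- apply: (left_adjoint_left_almost_split (F_gorenstein S)).
  exact: gorenstein_counit_iso S.
Qed.
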